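(* Let $G$ be a connected undirected graph and let $L=\{L_1,L_2,\dots,L_k\}$ be a partition of $V(G)$ such that for every edge $xy\in E(G)$, either $x,y\in L_i$ for some $1\le i\le k$, or (up to exchanging $x$ and $y$) $x\in L_i$, $y\in L_{i+1}$ for some $1\le i\le k-1$. Let $(X,T)$, with $X=\{X_j \mid j\in V(T)\}$, be a tree decomposition of $G$, and let $$t^*=\max\{|L_i\cap X_j| : 1\le i\le k,\ j\in V(T)\}.$$ Then there are a graph $G_1$ with $CCW(G_1)\le 2t^*-1$ and a chordal graph $G_2$ such that $G=G_1\cap G_2$.
   Context: Graphs are finite, simple and undirected. For graphs $H_1,\dots,H_d$ all having the same vertex set $V$, $G=\bigcap_{i=1}^d H_i$ means that $V(G)=V$ and $E(G)=\bigcap_{i=1}^d E(H_i)$; thus in $G=G_1\cap G_2$ one has $V(G_1)=V(G_2)=V(G)$ and $E(G)=E(G_1)\cap E(G_2)$. A clique cover of a graph $G$ is a partition of $V(G)$ into cliques. For an ordered clique cover $C=\{C_0,C_1,\dots,C_t\}$, its width is $W(C)=\max\{|j-i| : xy\in E(G),\ x\in C_i,\ y\in C_j\}$. The clique cover width $CCW(G)$ is the smallest width over all ordered clique covers of $G$. A tree decomposition of $G$ is a pair $(X,T)$ where $T$ is a tree and $X=\{X_j\mid j\in V(T)\}$ is a family of subsets of $V(G)$ (called bags) such that: $\bigcup_{j\in V(T)}X_j=V(G)$; for every $uv\in E(G)$ there is $j\in V(T)$ with $u,v\in X_j$; and for all $i,j,k\in V(T)$, if $j$ is on the path from $i$ to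 $k$ in $T$, then $X_i\cap X_k\subseteq X_j$. A graph is chordal if it has no induced (chordless) cycle of length at least four. *)

(* Defs.v *)
From mathcomp Require Import all_boot all_order all_algebra.
From mathcomp Require Import boolp.

Set Implicit Arguments.
Unset Strict Implicit.
Unset Printing Implicit Defensive.

Record sgraph (V : finType) := SGraph {
  adj :> rel V;
  adj_sym : symmetric adj;
  adj_irr : irreflexive adj
}.

(* The graph with no vertices is not connected. *)
Definition connected (V : finType) (G : sgraph V) : Prop :=
  0 < #|V| /\ forall x y : V, connect G x y.

Definition is_cycle (V : finType) (G : sgraph V) (c : seq V) : Prop :=
  2 < size c /\ ucycle G c.

Definition induced_cycle (V : finType) (G : sgraph V) (c : seq V) : Prop :=
  is_cycle G c /\
  {in c &, forall x y : V, G x y -> y = next c x \/ x = next c y}.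

Definition chordal (V : finType) (G : sgraph V) : Prop :=
  ~ exists c : seq V, induced_cycle G c /\ 4 <= size c.

Definition is_tree (I : finType) (T : sgraph I) : Prop :=
  connected T /\ ~ exists c : seq I, is_cycle T c.

Definition on_path (I : finType) (T : sgraph I) (i k j : I) : Prop :=
  exists p : seq I,
    [/\ path T i p, uniq (i :: p), last i p = k & j \in i :: p].

Definition tree_decomposition (V I : finType) (G : sgraph V) (T : sgraph I)
    (X : I -> {set V}) : Prop :=
  [/\ is_tree T,
      \bigcup_(j : I) X j = [set: V],
      forall u v : V, G u v -> exists j : I, u \in X j /\ v \in X j
    & forall i j k : I, on_path T i k j -> X i :&: X k \subset X j].

(* The blocks are non-empty, because set0 never belongs to a [partition]. *)
Definition ordered_partition (V : finType) (P : seq {set V}) : Prop :=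
  uniq P /\ partition [set:: P] [set: V].

Definition clique (V : finType) (G : sgraph V) (A : {set V}) : Prop :=
  {in A &, forall x y : V, x != y -> G x y}.

Definition ordered_clique_cover (V : finType) (G : sgraph V)
    (C : seq {set V}) : Prop :=
  ordered_partition C /\ {in C, forall A : {set V}, clique G A}.

(* The width of an edgeless graph is 0. *)
Definition width (V : finType) (G : sgraph V) (C : seq {set V}) : nat :=
  \max_(i < size C) \max_(j < size C |
      [exists x in nth set0 C i, exists y in nth set0 C j, G x y])
    `|j - i|%N.

Lemma exists_width (V : finType) (G : sgraph V) :
  exists w : nat,
    `[< exists C : seq {set V}, ordered_clique_cover G C /\ width G C = w >].
Proof.
pose C : seq {set V} := [seq [set x] | x <- enum V].
exists (width G C); apply/asboolP; exists C; split=> //; split.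
  split; first by rewrite map_inj_uniq ?enum_uniq //; apply: set1_inj.
  apply/and3P; split.
  - rewrite eqEsubset subsetT; apply/subsetP => x _.
    apply/bigcupP; exists [set x]; rewrite ?inE //.
    by apply: map_f; rewrite mem_enum.
  - apply/trivIsetP => A B; rewrite !inE => /mapP[x _ ->] /mapP[y _ ->] xy.
    rewrite disjoints1 inE; apply: contra xy => /eqP->; exact: eqxx.
  - rewrite inE; apply/negP => /mapP[x _ /setP/(_ x)].
    by rewrite !inE eqxx.
by move=> A /mapP[z _ ->] x y; rewrite !inE => /eqP-> /eqP->; rewrite eqxx.
Qed.

Definition CCW (V : finType) (G : sgraph V) : nat := ex_minn (exists_width G).

(* L_{i+1} for the last index i is read as set0, so contains no endpoint. *)
Definition layering (V : finType) (G : sgraph V) (L : seq {set V}) : Prop :=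
  ordered_partition L /\
  forall x y : V, G x y -> exists2 i : nat, i < size L &
    [\/ x \in nth set0 L i /\ y \in nth set0 L i,
        x \in nth set0 L i /\ y \in nth set0 L i.+1
      | y \in nth set0 L i /\ x \in nth set0 L i.+1].

Definition layer_bag_max (V I : finType) (L : seq {set V})
    (X : I -> {set V}) : nat :=
  \max_(i < size L) \max_(j : I) #|nth set0 L i :&: X j|.

Definition is_intersection (V : finType) (G G1 G2 : sgraph V) : Prop :=
  forall x y : V, G x y = G1 x y && G2 x y.

(* Main.v *)
(** Build up [T] one node at a time through connected subtrees, recording for
    each vertex [v] the step [d v] at which it is first met and the node [h v]
    where this happens.  If [u] and [v] share a bag and [d u <= d v], then
    [u] lies in the bag of [h v].  Hence the graph [G2] joining the vertices
    that share a bag is chordal (look at the vertex of largest [d] on a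
    cycle), and colouring greedily along [d] gives [t*] colours such that
    vertices sharing both a layer and a bag have distinct colours.  Place [v]
    at position [layer v * t* + colour v] and let [G1] be [G] together with
    all pairs at equal positions: these pairs are non-adjacent in [G2], and
    edges of [G], which join vertices in equal or consecutive layers, span at
    most [2 t* - 1] positions. *)

Require Import Defs.
From mathcomp Require Import all_boot all_order all_algebra.
From mathcomp Require Import boolp zify.

Set Implicit Arguments.
Unset Strict Implicit.
Unset Printing Implicit Defensive.

(** * Exploring the tree of a decomposition *)

Definition share_bag (V I : finType) (X : I -> {set V}) : rel V :=
  [rel x y | [exists j, (x \in X j) && (y \in X j)]].

Definition restr (I : finType) (T : sgraph I) (S : {set I}) : rel I :=
  [rel x y | [&& T x y, x \in S & y \in S]].

Lemma connected_boundary (I : finType) (T : sgraph I) (S : {set I}) (r k : I) :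
  connected T -> r \in S -> k \notin S ->
  exists s l : I, [/\ s \in S, l \notin S & T s l].
Proof.
move=> [_ cT] rS kS; have /connectP[p + kE] := cT r k.
rewrite {}kE in kS *; elim: p r rS kS => [|l p IH] r rS /=; first by rewrite rS.
move=> lS /andP[rl pl]; have [lS'|lS'] := boolP (l \in S).
  exact: (IH l lS' lS pl).
by exists r, l.
Qed.

Lemma restr_connect_sym (I : finType) (T : sgraph I) (S : {set I}) :
  connect_sym (restr T S).
Proof.
apply: sym_connect_sym => x y; rewrite /restr /=.
by rewrite (adj_sym T x) [(x \in S) && _]andbC.
Qed.

(** Shortening the walk inside [S] makes it simple, and appending [k], which lies outside [S], keeps
    it so. *)
Lemma on_path_restr (I : finType) (T : sgraph I) (S : {set I}) (i s k : I) :
  i \in S -> connect (restr T S) i s -> k \notin S -> T s k -> on_path T i k s.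
Proof.
move=> iS /connectP[p0 p0p ->] kS; case/shortenP: p0p => p pp up _ sk.
have pS : {subset i :: p <= S}.
  elim: p {up sk} i iS pp => [|y p IH] i iS /=.
    by move=> _ z; rewrite inE => /eqP->.
  move=> /andP[/and3P[_ _ yS] pp] z; rewrite inE => /predU1P[->//|].
  exact: (IH y yS pp).
exists (rcons p k); split.
- rewrite rcons_path sk andbT; apply: sub_path pp => x y.
  by case/and3P.
- by rewrite -rcons_cons rcons_uniq up andbT; apply: contra kS => /pS.
- by rewrite last_rcons.
- by rewrite -rcons_cons mem_rcons inE mem_last orbT.
Qed.

(** Read by decreasing [d], this is a perfect elimination order for bag sharing. *)
Lemma elimination_ranking (V I : finType) (G : sgraph V) (T : sgraph I)
    (X : I -> {set V}) :
  tree_decomposition G T X ->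
  exists (d : V -> nat) (h : V -> I),
    (forall v, v \in X (h v)) /\
    forall u v, share_bag X u v -> d u <= d v -> u \in X (h v).
Proof.
move=> [[cT _] covX _ pathX].
have [/card_gt0P[r _] _] := cT.
(* Here [S] is the set of explored nodes. The bound [d v <= n] leaves rank [n.+1] free for the
   vertices first met at the next node. *)
have grow n : n < #|I| -> exists (S : {set I}) (d : V -> nat) (h : V -> I),
  [/\ #|S| = n.+1, {in S &, forall i j, connect (restr T S) i j},
      forall v j, j \in S -> v \in X j -> v \in X (h v) /\ d v <= n
    & forall u v j, j \in S -> u \in X j -> v \in X j -> d u <= d v ->
        u \in X (h v)].
  elim: n => [_|n IH nI].
    exists [set r], (fun=> 0), (fun=> r); split=> [|i j||]; rewrite ?cards1 //.
    - by rewrite !inE => /eqP-> /eqP->.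
    - by move=> v j /set1P->.
    - by move=> u v j /set1P->.
  have [S [d [h [cS conS dh elimS]]]] := IH (ltnW nI).
  have [r' r'S] : exists r', r' \in S by apply/card_gt0P; rewrite cS.
  have [k0 k0S] : exists k0, k0 \notin S.
    apply/existsP; rewrite -negb_forall; apply: contraL nI => /forallP SI.
    by rewrite -leqNgt -cS subset_leq_card //; apply/subsetP => i _.
  have [s [k [sS kS sk]]] := connected_boundary cT r'S k0S.
  pose old v := [exists j in S, v \in X j].
  have oldP v j : j \in S -> v \in X j -> old v.
    by move=> jS vj; apply/existsP; exists j; rewrite jS.
  (* A path inside [S] from a node of [S] to [s] extends to [k], so [s]
     separates [k] from [S]. *)
  have old_s v : old v -> v \in X k -> v \in X s.
    case/existsP=> i /andP[iS vi] vk.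
    have /subsetP/(_ v) := pathX _ _ _ (on_path_restr iS (conS _ _ iS sS) kS sk).
    by apply; rewrite inE vi.
  (* All new vertices get the same rank; such ties are harmless, since those met at [k] lie in the
     bag of [k]. *)
  exists (k |: S), (fun v => if old v then d v else n.+1),
    (fun v => if old v then h v else k).
  have mono : {in S &, forall i j, connect (restr T (k |: S)) i j}.
    move=> i j iS jS; apply: (connect_sub _ (conS _ _ iS jS)) => x y /=.
    case/and3P=> xy xS yS; apply: connect1.
    by rewrite /restr /= xy !inE xS yS !orbT.
  have conk : {in S, forall i, connect (restr T (k |: S)) i k}.
    move=> i iS; apply: (connect_trans (mono _ _ iS sS)); apply: connect1.
    by rewrite /restr /= sk !inE eqxx sS orbT.
  split.
  - by rewrite cardsU1 kS cS.
  - move=> i j /setU1P[->|iS] /setU1P[->|jS]; rewrite ?connect0 //.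
    + by rewrite restr_connect_sym conk.
    + exact: conk.
    + exact: mono.
  - move=> v j jS vj; case: ifPn => [/existsP[i /andP[iS vi]]|vnew].
      by have [? ?] := dh _ _ iS vi; split=> //; apply: leqW.
    split=> //; case/setU1P: jS => [<-//|jS].
    by rewrite (oldP _ _ jS vj) in vnew.
  - move=> u v j /setU1P[-> uk vk|jS uj vj]; last first.
      by rewrite (oldP _ _ jS uj) (oldP _ _ jS vj); exact: elimS jS uj vj.
    (* Both vertices lie in the bag of [k]. If both are old, they also share the bag of [s]; if only
       [v] is old, then [d v <= n] contradicts [d u <= d v]. *)
    have [vold|_ _] := boolP (old v); last exact: uk.
    have [uold|_] := boolP (old u).
      exact: elimS sS (old_s _ uold uk) (old_s _ vold vk).
    case/existsP: vold => i /andP[iS vi].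
    by have [_ dv] := dh _ _ iS vi; rewrite leqNgt ltnS dv.
have I0 : 0 < #|I| by apply/card_gt0P; exists r.
have [|S [d [h [cS _ dh elimS]]]] := grow #|I|.-1; first by rewrite prednK.
have SI j : j \in S.
  suff -> : S = [set: I] by rewrite inE.
  by apply/eqP; rewrite eqEcard subsetT cardsT cS prednK /=.
exists d, h; split=> [v|u v /existsP[j /andP[uj vj]]]; last first.
  exact: elimS (SI j) uj vj.
have: v \in \bigcup_(j : I) X j by rewrite covX inE.
by case/bigcupP=> j _ vj; case: (dh v j (SI j) vj).
Qed.

(** * Greedy colouring along a ranking *)

Lemma greedy_coloring (V : finType) (e : rel V) (d : V -> nat) (t : nat) :
  symmetric e ->
  (forall v, #|[set u | [&& u != v, e u v & d u <= d v]]| < t) ->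
  exists c : V -> nat, (forall v, c v < t) /\
    forall u v, u != v -> e u v -> c u != c v.
Proof.
move=> e_sym deg.
suff part n : forall A : {set V}, #|A| = n ->
    exists c : V -> nat, (forall v, c v < t) /\
    {in A &, forall u v, u != v -> e u v -> c u != c v}.
  have [c [ct cP]] := part _ [set: V] erefl.
  by exists c; split=> // u v; apply: cP; rewrite inE.
elim: n => [|n IH] A cA.
  (* Colour 0 is legal: at any vertex [v], the bound [deg v] forces [t] to be positive. *)
  exists (fun=> 0); split=> [v|u v]; first exact: leq_ltn_trans (deg v).
  by rewrite (cards0_eq cA) inE.
have [v0 v0A] : exists v0, v0 \in A by apply/card_gt0P; rewrite cA.
pose v := [arg max_(x > v0 in A) d x].
have [vA vmax] : v \in A /\ {in A, forall u, d u <= d v}.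
  by rewrite /v; case: arg_maxnP => // x xA xmax; split=> // u /xmax.
have [|c [ct cP]] := IH (A :\ v); first by rewrite (cardsD1 v) vA in cA; case: cA.
pose N := [set u | [&& u != v, e u v & d u <= d v]].
(* Pigeonhole: if [N] showed all [t] colours, it would have at least [t] elements. *)
have [a aN] : exists a : 'I_t, (a : nat) \notin [seq c u | u in N].
  apply/existsP; rewrite -negb_forall; apply/negP => /forallP full.
  have : #|'I_t| <= #|[seq Ordinal (ct u) | u in N]|.
    apply/subset_leq_card/subsetP => a _; have /mapP[u uN aE] := full a.
    by apply/mapP; exists u => //; apply: val_inj.
  rewrite card_ord leqNgt => /negP; apply; apply: leq_ltn_trans (deg v).
  by apply: leq_trans (card_size _) _; rewrite size_image.
exists (fun u => if u == v then a : nat else c u); split=> [u|].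
  by case: ifP.
have new u : u \in A -> u != v -> e u v -> c u != a.
  move=> uA uv euv; apply: contra aN => /eqP<-; apply: image_f.
  by rewrite inE uv euv vmax.
move=> x y xA yA xy exy; case: (eqVneq x v) => xv; case: (eqVneq y v) => yv.
- by rewrite xv yv eqxx in xy.
- by rewrite eq_sym new // -xv e_sym.
- by rewrite new // -yv.
- by rewrite cP // !inE ?xv ?yv.
Qed.

(** * Chordality from a ranking *)

Lemma induced_cycle_rot (V : finType) (G : sgraph V) (n : nat) (c : seq V) :
  induced_cycle G c -> induced_cycle G (rot n c).
Proof.
move=> [[c3 /andP[cG uc]] chordless]; split.
  by split; rewrite ?size_rot // /ucycle rot_cycle rot_uniq cG.
move=> x y; rewrite !mem_rot => xc yc; rewrite !next_rot //.
exact: chordless.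
Qed.

Lemma chordal_ranking (V : finType) (G : sgraph V) (d : V -> nat) :
  (forall v x y, x != y -> G v x -> G v y -> d x <= d v -> d y <= d v ->
     G x y) ->
  chordal G.
Proof.
move=> elim [c [indc c4]].
have [v0 v0c] : exists v0, v0 \in c.
  by case: c c4 {indc} => // v0 c; exists v0; apply: mem_head.
pose v := [arg max_(x > v0 in c) d x].
have [vc vmax] : v \in c /\ {in c, forall u, d u <= d v}.
  by rewrite /v; case: arg_maxnP => // x xc xmax; split=> // u /xmax.
(* With the top vertex [v] rotated to the front, its cycle neighbours are the second vertex [y] and
   the last vertex [x]; length at least 4 makes the edge [x y] a chord. *)
have [n s cE] := rot_to vc.
have := induced_cycle_rot n indc; rewrite cE.
have vmax' : {in v :: s, forall u, d u <= d v}.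
  by move=> u; rewrite -cE mem_rot; apply: vmax.
have : 3 < size (v :: s) by rewrite -cE size_rot.
case: s {cE} vmax' => [|y [|z [|w s]]] // vmax' _ [[_ /andP[cG uc]] chordless].
set x := last w s.
have xc : x \in w :: s by apply: mem_last.
have vy : G v y by move: cG => /= /andP[].
have vx : G v x.
  by rewrite adj_sym; move: cG; rewrite /= rcons_path => /and4P[_ _ _ /andP[]].
have /and4P[vN yN zN _] := uc.
have yx : y != x.
  by apply: contraNneq yN => ->; rewrite in_cons xc orbT.
have xin : x \in [:: v, y, z, w & s] by rewrite 3!inE xc !orbT.
have yin : y \in [:: v, y, z, w & s] by rewrite !inE eqxx orbT.
have vyN : v != y by apply: contraNneq vN => ->; apply: mem_head.
have Gyx : G y x by apply: (elim v) => //; apply: vmax'.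
have next_y : next [:: v, y, z, w & s] y = z.
  by rewrite /= eq_sym (negPf vyN) eqxx.
have next_x : next [:: v, y, z, w & s] x = v.
  have cE : [:: v, y, z, w & s] = rcons (belast v [:: y, z, w & s]) x.
    by rewrite lastI.
  by rewrite -(next_rotr 1 uc) cE rotr1_rcons /= eqxx.
(* The successors of [y] and [x] are [z] and [v], so chordlessness would give [x = z] or [y = v],
   against uniqueness. *)
case: (chordless _ _ yin xin Gyx) => [xE|yE].
- by rewrite next_y in xE; rewrite -xE xc in zN.
- by rewrite next_x in yE; rewrite yE eqxx in vyN.
Qed.

(** * Clique cover width from positions on a line *)

Lemma sorted_ltn_nth_gap (s : seq nat) (i j : nat) :
  sorted ltn s -> i <= j -> j < size s -> j - i <= nth 0 s j - nth 0 s i.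
Proof.
move=> ss; elim: j => [|j IH]; first by rewrite leqn0 => /eqP->.
rewrite leq_eqVlt => /predU1P[->|ij jlt]; first by rewrite subnn.
have := IH ij (ltnW jlt).
have : nth 0 s j < nth 0 s j.+1.
  by apply: (sorted_ltn_nth ltn_trans) => //; rewrite inE // ltnW.
(* Needed because subtraction is truncated. *)
have : nth 0 s i <= nth 0 s j.
  apply: (sorted_leq_nth leq_trans leqnn) => //; rewrite ?inE; [|lia|lia].
  by apply: sub_sorted ss; apply: ltnW.
lia.
Qed.

(** The non-empty fibres of [f], in increasing order, form a clique cover; dropping the empty ones
    never increases an index distance. *)
Lemma CCW_position (V : finType) (G : sgraph V) (f : V -> nat) (w : nat) :
  (forall x y, x != y -> f x = f y -> G x y) ->
  (forall x y, G x y -> f x <= f y + w) ->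
  CCW G <= w.
Proof.
move=> fibre edge.
pose B n := [set v | f v == n].
pose s := [seq n <- iota 0 (\max_v f v).+1 | B n != set0].
have sP v : f v \in s.
  rewrite mem_filter mem_iota ltnS leq_bigmax leq0n !andbT.
  by apply/set0Pn; exists v; rewrite inE.
have Binj : {in s &, injective B}.
  move=> m n; rewrite mem_filter => /andP[/set0Pn[v vm] _] _ BE.
  by move: (vm); rewrite BE; move: vm; rewrite !inE => /eqP-> /eqP.
have ss : sorted ltn s.
  by apply: sorted_filter (iota_ltn_sorted _ _); apply: ltn_trans.
pose C := [seq B n | n <- s].
have coverC : ordered_clique_cover G C.
  split; last first.
    move=> A /mapP[n _ ->] x y; rewrite !inE => /eqP xn /eqP yn xy.
    by apply: fibre => //; rewrite xn.
  split; first by rewrite map_inj_in_uniq // filter_uniq // iota_uniq.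
  apply/and3P; split.
  - rewrite eqEsubset subsetT; apply/subsetP => v _.
    by apply/bigcupP; exists (B (f v)); rewrite inE // map_f.
  - apply/trivIsetP => A A'; rewrite !inE => /mapP[m ms ->] /mapP[n ns ->] mn.
    rewrite -setI_eq0; apply/set0Pn => -[v]; rewrite !inE => /andP[/eqP vm /eqP vn].
    by rewrite -vm -vn eqxx in mn.
  - rewrite inE; apply/mapP => -[n]; rewrite mem_filter => /andP[n0 _] E.
    by rewrite -E eqxx in n0.
rewrite /CCW; case: ex_minnP => m _ min.
apply: leq_trans (min (width G C) _) _.
  by apply/asboolP; exists C.
apply/bigmax_leqP => i _; apply/bigmax_leqP => j.
have sC : size C = size s by rewrite size_map.
have ilt : i < size s by rewrite -sC.
have jlt : j < size s by rewrite -sC.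
rewrite !(nth_map 0) //.
case/existsP=> x /andP[xi /existsP[y /andP[yj xy]]].
rewrite !inE in xi yj.
(* [edge] is one-sided, so both orientations are used to bound the absolute difference. *)
have := edge _ _ xy; rewrite adj_sym in xy; have := edge _ _ xy.
rewrite (eqP xi) (eqP yj).
have gap := sorted_ltn_nth_gap ss.
case: (leqP i j) => [ij|/ltnW ij].
  by have := gap _ _ ij jlt; lia.
by have := gap _ _ ij ilt; lia.
Qed.

(** * Layer indices *)

Definition layer (V : finType) (L : seq {set V}) (v : V) : nat :=
  find (fun A : {set V} => v \in A) L.

Lemma layerE (V : finType) (L : seq {set V}) (v : V) (i : nat) :
  ordered_partition L -> v \in nth set0 L i -> layer L v = i.
Proof.
move=> [uL /and3P[_ /trivIsetP triv _]] vi.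
(* Past the end [nth] returns [set0], so membership alone puts [i] in range. *)
have iL : i < size L.
  by rewrite ltnNge; apply: contraL vi => /(nth_default set0)->; rewrite inE.
have hasv : has (fun A : {set V} => v \in A) L.
  by apply/hasP; exists (nth set0 L i) => //; apply: mem_nth.
have vl := nth_find set0 hasv; rewrite -/(layer L v) in vl.
have lL : layer L v < size L by rewrite -has_find.
apply/eqP; rewrite -(nth_uniq set0 lL iL uL); apply/negPn/negP => li.
have := triv _ _ _ _ li; rewrite !inE !mem_nth // => /(_ isT isT).
by move/pred0P/(_ v); rewrite /= vl vi.
Qed.

Lemma mem_layer (V : finType) (L : seq {set V}) (v : V) :
  ordered_partition L -> layer L v < size L /\ v \in nth set0 L (layer L v).
Proof.
move=> [_ /and3P[/eqP cov _ _]].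
have : v \in cover [set:: L] by rewrite cov inE.
case/bigcupP=> A; rewrite inE => AL vA.
have hasv : has (fun A : {set V} => v \in A) L by apply/hasP; exists A.
by rewrite -has_find; split=> //; apply: (nth_find set0 hasv).
Qed.

Lemma layer_edge (V : finType) (G : sgraph V) (L : seq {set V}) (x y : V) :
  layering G L -> G x y -> layer L x <= (layer L y).+1.
Proof.
move=> [pL eL] /eL[i _ [] []] /(layerE pL)-> /(layerE pL)->; lia.
Qed.

(** * The two factor graphs *)

Definition bag_adj (V I : finType) (X : I -> {set V}) : rel V :=
  [rel x y | (x != y) && share_bag X x y].

Lemma share_bag_sym (V I : finType) (X : I -> {set V}) :
  symmetric (share_bag X).
Proof. by move=> x y; rewrite /share_bag /=; apply: eq_existsb => j; rewrite andbC. Qed.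

Lemma bag_adj_sym (V I : finType) (X : I -> {set V}) : symmetric (bag_adj X).
Proof. by move=> x y; rewrite /bag_adj /= eq_sym -!/(share_bag X _ _) share_bag_sym. Qed.

Lemma bag_adj_irr (V I : finType) (X : I -> {set V}) :
  irreflexive (bag_adj X).
Proof. by move=> x; rewrite /bag_adj /= eqxx. Qed.

Definition bag_graph (V I : finType) (X : I -> {set V}) : sgraph V :=
  SGraph (@bag_adj_sym V I X) (@bag_adj_irr V I X).

Definition merge_adj (V : finType) (G : sgraph V) (f : V -> nat) : rel V :=
  [rel x y | G x y || (x != y) && (f x == f y)].

Lemma merge_adj_sym (V : finType) (G : sgraph V) (f : V -> nat) :
  symmetric (merge_adj G f).
Proof. by move=> x y; rewrite /merge_adj /= (adj_sym G x) eq_sym [f x == _]eq_sym. Qed.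

Lemma merge_adj_irr (V : finType) (G : sgraph V) (f : V -> nat) :
  irreflexive (merge_adj G f).
Proof. by move=> x; rewrite /merge_adj /= adj_irr eqxx. Qed.

Definition merge_graph (V : finType) (G : sgraph V) (f : V -> nat) :
  sgraph V := SGraph (merge_adj_sym G f) (merge_adj_irr G f).

Theorem theorem2 (V I : finType) (G : sgraph V) (L : seq {set V})
    (T : sgraph I) (X : I -> {set V})
    (connG : connected G)
    (layL : layering G L)
    (tdX : tree_decomposition G T X) :
  exists G1 G2 : sgraph V,
    [/\ CCW G1 <= 2 * layer_bag_max L X - 1,
        chordal G2
      & is_intersection G G1 G2].
Proof.
have [d [h [vh elim]]] := elimination_ranking tdX.
have [pL _] := layL; have [_ _ edgeX _] := tdX.
set t := layer_bag_max L X.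
pose e := [rel u v | (layer L u == layer L v) && share_bag X u v].
have e_sym : symmetric e.
  by move=> u v; rewrite /e /= eq_sym share_bag_sym.
have [|c [ct cP]] := @greedy_coloring V e d t e_sym.
  move=> v; have [lL vl] := mem_layer v pL.
  have A_le : #|nth set0 L (layer L v) :&: X (h v)| <= t.
    apply: leq_trans (leq_bigmax (Ordinal lL)).
    exact: (leq_bigmax (h v)).
  (* The conflicting vertices of no larger rank lie in this layer and bag; so does [v], which is not
     among them, hence the strict bound. *)
  apply: leq_trans A_le; apply: proper_card; apply/properP; split.
    apply/subsetP => u; rewrite !inE => /and3P[_ /andP[/eqP uv share] duv].
    by rewrite elim // andbT -uv; case: (mem_layer u pL).
  by exists v; rewrite !inE ?eqxx ?vl ?vh.
(* As [c v < t], division by [t] recovers the layer and the remainder is the colour. *)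
pose f v := layer L v * t + c v.
have fE x y : f x = f y -> layer L x = layer L y /\ c x = c y.
  move=> fxy; have t0 : 0 < t by apply: leq_ltn_trans (ct x).
  have : layer L x = layer L y.
    move/(congr1 (fun n => n %/ t)): fxy.
    by rewrite /f !divnMDl // !divn_small ?ct // !addn0.
  by move=> lxy; split=> //; move: fxy; rewrite /f lxy => /addnI.
exists (merge_graph G f), (bag_graph X); split.
- apply: (@CCW_position _ _ f) => x y; rewrite /= /merge_adj /=.
    by move=> -> ->; rewrite eqxx orbT.
  case/orP=> [xy|/andP[_ /eqP->]]; last exact: leq_addr.
  (* The layers contribute at most [t] and the colours at most [t - 1]. *)
  have lxy := layer_edge layL xy; have cx := ct x.
  rewrite /f; have := leq_mul2r t (layer L x) (layer L y).+1.
  rewrite lxy orbT mulSn; lia.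
- apply: (@chordal_ranking _ _ d) => v x y xy /andP[_ vx] /andP[_ vy] dx dy.
  rewrite /= /bag_adj /= xy; apply/existsP; exists (h v).
  by rewrite !elim // share_bag_sym.
- move=> x y; rewrite /= /merge_adj /bag_adj /=; apply/idP/idP => [xy|].
    rewrite xy /=; apply/andP; split.
      by apply: contraTneq xy => ->; rewrite adj_irr.
    by have [j [xj yj]] := edgeX _ _ xy; apply/existsP; exists j; rewrite xj.
  (* A merged pair has equal layer and colour; sharing a bag would force distinct colours. *)
  case/andP=> /orP[//|/andP[xy /eqP/fE[lxy cxy]]] /andP[_ share].
  by have := cP x y xy; rewrite /e /= lxy eqxx cxy eqxx => /(_ share).
Qed.
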